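(* Let $\triangle$ be the Sierpiński gasket, let $f \in C(\triangle,\mathbb{R})$ be fixed, and let $b \in C(\triangle,\mathbb{R})$ satisfy $b(p)=f(p)$ for all $p \in V_0$. Let $r<1$ be a fixed real number and let $S=\{\alpha \in \mathbb{R}^3 : |\alpha|_\infty \le r\}$. Then the map $W : S \to C(\triangle,\mathbb{R})$ defined by $W(\alpha)=f_b^\alpha$ is continuous, where $f_b^\alpha$ is the $\alpha$-fractal function associated with $f$ with respect to the base function $b$ and the scale vector $\alpha$.
   Context: Let $V_0=\{x_1,x_2,x_3\}\subset\mathbb{R}^2$ be a set of three distinct points with equal pairwise distances (the vertices of an equilateral triangle). For $i=1,2,3$ let $u_i:\mathbb{R}^2\to\mathbb{R}^2$, $u_i(t)=\frac12(t+x_i)$. The Sierpiński gasket $\triangle$ is the attractor of this iterated function system, i.e. the unique nonempty compact set with $\triangle=\bigcup_{i=1}^3 u_i(\triangle)$. $C(\triangle,\mathbb{R})$ denotes the space of continuous real-valued functions on $\triangle$, equipped with the uniform norm $\|g\|_\infty=\sup_{t\in\triangle}|g(t)|$. For $\alpha=(\alpha_1,\alpha_2,\alpha_3)\in\mathbb{R}^3$, $|\alpha|_\infty=\max_i|\alpha_i|$; $\mathbb{R}^3$ carries this norm. Given $f\in C(\triangle,\mathbb{R})$ (original function), $b\in C(\triangle,\mathbb{R})$ (base function) with $b|_{V_0}=f|_{V_0}$, and a scale vector $\alpha\in\mathbb{R}^3$ with $|\alpha|_\infty<1$, the $\alpha$-fractal function $f_b^\alpha$ is the unique continuous function $\triangle\to\mathbb{R}$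 satisfying $$f_b^\alpha(t)=f(t)+\alpha_i\,(f_b^\alpha-b)(u_i^{-1}(t))\quad\text{for all } t\in u_i(\triangle),\ i\in\{1,2,3\}.$$ (Its graph is the attractor of the iterated function system on $\triangle\times\mathbb{R}$ given by the maps $H_i(t,x)=(u_i(t),\ \alpha_i x+f(u_i(t))-\alpha_i b(t))$, $i=1,2,3$. The existence and uniqueness of $f_b^\alpha$ is a known result.) *)

(* Defs.v *)
From HB Require Import structures.
From mathcomp Require Import all_boot all_order all_algebra.
From mathcomp Require Import all_classical all_reals all_analysis.

Set Implicit Arguments.
Unset Strict Implicit.
Unset Printing Implicit Defensive.

Import Order.TTheory GRing.Theory Num.Theory.
Import numFieldNormedType.Exports.

Local Open Scope classical_set_scope.
Local Open Scope ring_scope.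

(* The library norm of 'rV[R]_2 is the sup norm: it gives the usual topology
   of the plane, but distances between vertices have to be Euclidean. *)
Definition euclidean_dist (R : realType) (p q : 'rV[R]_2) : R :=
  Num.sqrt (\sum_(k < 2) (p 0 k - q 0 k) ^+ 2).

Definition equilateral (R : realType) (x : 'I_3 -> 'rV[R]_2) : Prop :=
  injective x /\
  forall i j k l : 'I_3, i != j -> k != l ->
    euclidean_dist (x i) (x j) = euclidean_dist (x k) (x l).

Definition gasket_map (R : realType) (x : 'I_3 -> 'rV[R]_2) (i : 'I_3)
    (t : 'rV[R]_2) : 'rV[R]_2 :=
  2^-1 *: (t + x i).

Definition is_sierpinski_gasket (R : realType) (x : 'I_3 -> 'rV[R]_2)
    (K : set 'rV[R]_2) : Prop :=
  [/\ K !=set0, compact K & K = \bigcup_(i : 'I_3) (gasket_map x i @` K)].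

(* K is used as a type, with the topology induced by the plane. *)
Definition cont_fun (R : realType) (K : set 'rV[R]_2) := continuousType K R.

Definition sup_norm (R : realType) (K : set 'rV[R]_2) (g : K -> R) : R :=
  sup (range (fun t : K => `|g t|)).

(* Since gasket_map x i is injective, the premise relating s and t says that
   t lies in its image of K and that s is the preimage of t. *)
Definition is_fractal_fun (R : realType) (x : 'I_3 -> 'rV[R]_2)
    (K : set 'rV[R]_2) (f b : cont_fun K) (alpha : 'rV[R]_3)
    (g : cont_fun K) : Prop :=
  forall (i : 'I_3) (s t : K), set_val t = gasket_map x i (set_val s) ->
    g t = f t + alpha 0 i * (g s - b s).

(* Definite description: when b = f on the vertices and `|alpha| < 1 there is
   exactly one such function; the default value f is then irrelevant. *)
Definition fractal_fun (R : realType) (x : 'I_3 -> 'rV[R]_2)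
    (K : set 'rV[R]_2) (f b : cont_fun K) (alpha : 'rV[R]_3) : cont_fun K :=
  xget f [set g | is_fractal_fun x f b alpha g].

(* The library norm of 'rV[R]_3 is max_i `|alpha 0 i|. *)
Definition scale_vectors (R : realType) (r : R) : set 'rV[R]_3 :=
  [set alpha | `|alpha| <= r].

(* Continuity for the distance sup_norm (g - h) on the target. *)
Definition sup_norm_continuous (R : realType) (T : topologicalType)
    (K : set 'rV[R]_2) (W : T -> cont_fun K) : Prop :=
  forall a : T, sup_norm (W c \- W a) @[c --> a] --> (0 : R).

(* Main.v *)
(* For e = g - b the equation of a fractal function reads
   e(t) = (f - b)(t) + alpha_i e(s) whenever t = u_i(s).  Choosing one such
   (i, s) for every t turns it into e = q + a * (e o sigma) with |a| <= r < 1,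
   solved by a geometrically convergent series.  The choice is immaterial: in
   barycentric coordinates the cells u_i(K) and u_j(K) can meet only at
   u_i(x_j) = u_j(x_i), and e vanishes at the vertices because f - b does.  By
   the same remark the partial sums are continuous by pasting along the closed
   cells, and e is their uniform limit, so fractal functions exist.  Comparing
   the equations for alpha and beta gives the Lipschitz estimate
   |g - h| <= |alpha - beta| |h - b| / (1 - r). *)
Require Import Defs.
From mathcomp Require Import all_boot all_order all_algebra.
From mathcomp Require Import all_classical all_reals all_analysis.
From mathcomp Require Import zify ring lra.

Set Implicit Arguments.
Unset Strict Implicit.
Unset Printing Implicit Defensive.

Import Order.TTheory GRing.Theory Num.Theory.
Import numFieldNormedType.Exports.

Local Open Scope classical_set_scope.
Local Open Scope ring_scope.

(** * Barycentric coordinates in the plane *)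

Definition det2 (R : realType) (u v : 'rV[R]_2) : R :=
  u 0 0 * v 0 1 - u 0 1 * v 0 0.

(** The barycentric coordinate of [t] at the vertex [p] of the triangle [p], [q], [w], as a ratio of
    signed areas. *)
Definition bary (R : realType) (p q w t : 'rV[R]_2) : R :=
  det2 (t - q) (w - q) / det2 (p - q) (w - q).

Lemma ord2_eq (k : 'I_2) : k = 0 \/ k = 1.
Proof. by case: k => [[|[|//]]] ?; [left|right]; exact: val_inj. Qed.

Lemma row2P (R : realType) (u v : 'rV[R]_2) :
  u 0 0 = v 0 0 -> u 0 1 = v 0 1 -> u = v.
Proof.
by move=> e0 e1; apply/rowP => k; case: (ord2_eq k) => ->.
Qed.

(** With [L] the squared side, the edges at [x j] have inner product [L / 2]. If the determinant
    vanished, Lagrange's identity would give [L ^ 2 = L ^ 2 / 4], hence [L = 0] and [x i = x j]. *)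
Lemma det2_equilateral (R : realType) (x : 'I_3 -> 'rV[R]_2) (i j k : 'I_3) :
  equilateral x -> i != j -> k != j -> i != k ->
  det2 (x i - x j) (x k - x j) != 0.
Proof.
move=> [x_inj x_dist] ij kj ik.
have dist2 p q : euclidean_dist p q ^+ 2 =
    (p 0 0 - q 0 0) ^+ 2 + (p 0 1 - q 0 1) ^+ 2 :> R.
  rewrite /euclidean_dist sqr_sqrtr ?sumr_ge0// => [|l _]; last exact: sqr_ge0.
  by rewrite !big_ord_recl big_ord0 addr0; congr ((_ - _) ^+ 2 + (_ - _) ^+ 2);
    congr (_ _ _); exact: val_inj.
have := congr1 (fun d => d ^+ 2) (x_dist _ _ _ _ ij kj).
have := congr1 (fun d => d ^+ 2) (x_dist _ _ _ _ ij ik).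
rewrite !dist2 => e1 e2; apply: contra ij => /eqP.
rewrite /det2 !mxE => det0; apply/eqP/x_inj.
set a0 := x i 0 0 in e1 e2 det0 *; set a1 := x i 0 1 in e1 e2 det0 *.
set b0 := x j 0 0 in e1 e2 det0 *; set b1 := x j 0 1 in e1 e2 det0 *.
set c0 := x k 0 0 in e1 e2 det0 *; set c1 := x k 0 1 in e1 e2 det0 *.
pose L := (a0 - b0) ^+ 2 + (a1 - b1) ^+ 2.
have dotE : (a0 - b0) * (c0 - b0) + (a1 - b1) * (c1 - b1) = L / 2.
  by rewrite /L; lra.
have L0 : L = 0.
  have : L * ((c0 - b0) ^+ 2 + (c1 - b1) ^+ 2) = (L / 2) ^+ 2.
    rewrite -dotE.
    have -> : L * ((c0 - b0) ^+ 2 + (c1 - b1) ^+ 2) =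
      ((a0 - b0) * (c1 - b1) - (a1 - b1) * (c0 - b0)) ^+ 2 +
      ((a0 - b0) * (c0 - b0) + (a1 - b1) * (c1 - b1)) ^+ 2 by rewrite /L; ring.
    by rewrite det0 expr0n add0r.
  rewrite -e2 -/L => LL; apply/eqP; rewrite -sqrf_eq0; apply/eqP; lra.
have s0 := sqr_ge0 (a0 - b0); have s1 := sqr_ge0 (a1 - b1).
apply: row2P; apply/eqP; rewrite -subr_eq0 -sqrf_eq0 -/a0 -/a1 -/b0 -/b1;
  apply/eqP; rewrite /L in L0; lra.
Qed.

Lemma bary_affine (R : realType) (p q w s t : 'rV[R]_2) :
  bary p q w (2^-1 *: (s + t)) = 2^-1 * (bary p q w s + bary p q w t).
Proof. by rewrite /bary /det2 !mxE; lra. Qed.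

Lemma bary_self (R : realType) (p q w : 'rV[R]_2) :
  det2 (p - q) (w - q) != 0 -> bary p q w p = 1.
Proof. by move=> d0; rewrite /bary divff. Qed.

Lemma bary_basepoint (R : realType) (p q w : 'rV[R]_2) : bary p q w q = 0.
Proof. by rewrite /bary /det2 !mxE !subrr !mul0r subrr mul0r. Qed.

Lemma bary_endpoint (R : realType) (p q w : 'rV[R]_2) : bary p q w w = 0.
Proof. by rewrite /bary /det2 [(w - q) 0 1 * _]mulrC subrr mul0r. Qed.

Lemma bary_continuous (R : realType) (p q w : 'rV[R]_2) :
  continuous (bary p q w).
Proof.
have subMC k c : continuous ((fun t => (t 0 k - q 0 k) * c) : 'rV[R]_2 -> R).
  move=> t; apply: (@continuousM R 'rV[R]_2 (fun t => t 0 k - q 0 k) (cst c)).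
    by apply: continuousB; [exact: coord_continuous|exact: cst_continuous].
  exact: cst_continuous.
rewrite (_ : bary p q w = fun t => ((t 0 0 - q 0 0) * (w - q) 0 1 -
  (t 0 1 - q 0 1) * (w - q) 0 0) * (det2 (p - q) (w - q))^-1).
  move=> t; apply: (@continuousM R 'rV[R]_2 (fun t =>
    (t 0 0 - q 0 0) * (w - q) 0 1 - (t 0 1 - q 0 1) * (w - q) 0 0) (cst _)).
    by apply: continuousB; exact: subMC.
  exact: cst_continuous.
by apply/funext => t; rewrite /bary {1}/det2 !mxE.
Qed.

(* The three coordinates sum to 1, so those at q and w vanish. *)
Lemma bary_vertex (R : realType) (p q w t : 'rV[R]_2) :
  det2 (p - q) (w - q) != 0 ->
  1 <= bary p q w t -> 0 <= bary q w p t -> 0 <= bary w p q t -> t = p.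
Proof.
move=> d0; rewrite /bary.
have -> : det2 (q - w) (p - w) = det2 (p - q) (w - q).
  by rewrite /det2 !mxE; ring.
have -> : det2 (w - p) (q - p) = det2 (p - q) (w - q).
  by rewrite /det2 !mxE; ring.
set D := det2 (p - q) (w - q) in d0 *.
set u := (X in 1 <= X -> _); set v := (X in _ -> 0 <= X -> _).
set z := (X in _ -> _ -> 0 <= X -> _) => u1 v0 z0.
have sum1 : u + v + z = 1.
  by rewrite /u /v /z -!mulrDl -(divff d0); congr (_ / _);
    rewrite /D /det2 !mxE; ring.
have {}v0 : v = 0 by lra.
have {}z0 : z = 0 by lra.
(* So [t] lies on two lines through [p] whose directions are independent by [d0]; Cramer's rule
   leaves only [p]. *)
have eqv : det2 (t - w) (p - w) = 0.
  by rewrite -(divfK d0 (det2 _ _)) -/v v0 mul0r.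
have eqz : det2 (t - p) (q - p) = 0.
  by rewrite -(divfK d0 (det2 _ _)) -/z z0 mul0r.
move: eqv eqz; rewrite /det2 !mxE => eqv eqz.
have cramer k : D * t 0 k = D * p 0 k.
  have := congr1 ( *%R (q 0 k - p 0 k)) eqv.
  have := congr1 ( *%R (p 0 k - w 0 k)) eqz.
  by case: (ord2_eq k) => ->; rewrite /D /det2 !mxE; lra.
by apply: row2P; exact: (mulfI d0).
Qed.

(** * The similarities and the overlap of their cells *)

Lemma double_gasket_map (R : realType) (x : 'I_3 -> 'rV[R]_2) (i : 'I_3)
    (t : 'rV[R]_2) :
  2 *: gasket_map x i t = t + x i.
Proof. by rewrite /gasket_map scalerA divff ?pnatr_eq0// scale1r. Qed.

Lemma gasket_map_inj (R : realType) (x : 'I_3 -> 'rV[R]_2) (i : 'I_3) :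
  injective (gasket_map x i).
Proof.
by move=> s t /(congr1 ( *:%R 2)); rewrite !double_gasket_map => /addIr.
Qed.

Lemma ord3_cover (l m n : 'I_3) : l != m -> n != m -> l != n ->
  forall o, [\/ o = l, o = m | o = n].
Proof.
move=> lm nm ln o; have [ol|ol] := eqVneq o l; first by constructor 1.
have [om|om] := eqVneq o m; first by constructor 2.
constructor 3; apply: val_inj.
have := ltn_ord l; have := ltn_ord m; have := ltn_ord n; have := ltn_ord o.
by move: lm nm ln ol om; rewrite -!val_eqE /=; lia.
Qed.

Lemma ord3_third (i j : 'I_3) : i != j ->
  exists k : 'I_3, [/\ k != i, k != j & i != k].
Proof.
(* The indices 0, 1, 2 sum to 3. *)
move=> ij; have k3 : (3 - (i + j) < 3)%N by move: ij; rewrite -val_eqE /=; lia.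
exists (Ordinal k3); have := ltn_ord i; have := ltn_ord j.
by move: ij; rewrite -!val_eqE /=; split; lia.
Qed.

(** A minimum over [K] is attained at some [m = u_i(s)], where the value is the mean of those at [s]
    and [x i]. The former is at least the minimum and the latter at least 0, so the minimum is
    nonnegative. *)
Lemma gasket_bary_ge0 (R : realType) (x : 'I_3 -> 'rV[R]_2) (K : set 'rV[R]_2)
    (p q w : 'rV[R]_2) :
  is_sierpinski_gasket x K -> (forall i, 0 <= bary p q w (x i)) ->
  forall t, K t -> 0 <= bary p q w t.
Proof.
move=> [K0 Kc KE] vx_ge0.
have [m] := @compact_EVT_min _ R (bary p q w) K K0 Kc
  (continuous_subspaceT (@bary_continuous R p q w)).
rewrite inE => Km minm t Kt.
apply: le_trans (minm t (mem_set Kt)).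
have := Km; rewrite {1}KE => -[i _ [s Ks sm]].
have := minm s (mem_set Ks); have := vx_ge0 i.
by rewrite -sm /gasket_map bary_affine; lra.
Qed.

(* By affinity u_i(s) = u_j(s') gives bary_j s = bary_j s' + 1 >= 1. *)
Lemma gasket_overlap (R : realType) (x : 'I_3 -> 'rV[R]_2) (K : set 'rV[R]_2)
    (i j : 'I_3) (s s' : 'rV[R]_2) :
  equilateral x -> is_sierpinski_gasket x K -> i != j -> K s -> K s' ->
  gasket_map x i s = gasket_map x j s' -> s = x j.
Proof.
move=> xE hK ij Ks Ks' /(congr1 ( *:%R 2)).
rewrite !double_gasket_map => ss'.
have [k [ki kj ik]] := ord3_third ij.
have bary_ge0 l m n t : l != m -> n != m -> l != n -> K t ->
    0 <= bary (x l) (x m) (x n) t.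
  move=> lm nm ln; apply: (gasket_bary_ge0 hK) => o.
  have d0 := det2_equilateral xE lm nm ln.
  have [->|->|->] := ord3_cover lm nm ln o.
  - by rewrite bary_self.
  - by rewrite bary_basepoint.
  - by rewrite bary_endpoint.
have ji : j != i by rewrite eq_sym.
have jk : j != k by rewrite eq_sym.
apply: (@bary_vertex _ (x j) (x i) (x k)).
- exact: det2_equilateral.
- have d0 := det2_equilateral xE ji ki jk.
  have := congr1 (fun t => bary (x j) (x i) (x k) (2^-1 *: t)) ss'.
  rewrite !bary_affine bary_basepoint bary_self//.
  have := bary_ge0 j i k s' ji ki jk Ks'; lra.
- exact: bary_ge0.
- exact: bary_ge0.
Qed.

(** * Pointwise series solution and continuity on the gasket *)

Lemma discounted_sum (R : realType) (T : Type) (sigma : T -> T)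
    (a q : T -> R) (r M : R) :
  0 <= r < 1 -> 0 <= M -> (forall t, `|a t| <= r) -> (forall t, `|q t| <= M) ->
  exists2 e : T -> R, forall t, e t = q t + a t * e (sigma t) &
    forall t, `|e t| <= M / (1 - r).
Proof.
move=> /andP[r0 r1] M0 ar qM.
(* The n-th term is the product of [a] along the first n points of the [sigma]-orbit of [t], times
   [q] at the next one. *)
pose u := fix u n t := if n is m.+1 then a t * u m (sigma t) else q t.
have uM n t : `|u n t| <= geometric M r n.
  elim: n t => [|n IHn] t /=; first by rewrite mulr1.
  by rewrite normrM exprS mulrCA ler_pM.
have rN1 : `|r| < 1 by rewrite ger0_norm.
have geo := is_cvg_geometric_series (a := M) rN1.
have normu_cvg t : cvgn [normed series (u ^~ t)].
  by apply: series_le_cvg geo => n //=; exact: le_trans (uM n t).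
have u_cvg t := normed_cvg (normu_cvg t).
exists (fun t => limn (series (u ^~ t))) => t.
  (* Splitting off the zeroth term of the shifted partial sums yields the functional equation. *)
  apply: cvg_lim => //; rewrite -cvg_shiftS.
  rewrite (_ : [sequence _]_n =
      fun n => q t + a t * series (u ^~ (sigma t)) n).
    apply: cvgD; first exact: cvg_cst.
    by apply: cvgM; [exact: cvg_cst|exact: u_cvg].
  apply/funext => n /=; rewrite /series /= big_nat_recl//; congr (_ + _).
  by rewrite big_distrr.
apply: le_trans (lim_series_norm (normu_cvg t)) _.
rewrite -(cvg_lim _ (cvg_geometric_series (a := M) rN1)) //.
by apply: lim_series_le => [| |n]; [exact: normu_cvg|exact: geo|exact: uM].
Qed.

Lemma cts_gasket_bounded (R : realType) (K : set 'rV[R]_2) (g : K -> R) :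
  compact K -> continuous g -> exists2 M, 0 <= M & forall t, `|g t| <= M.
Proof.
(* Extending [g] to the plane by a default value keeps it continuous on the subspace [K], where
   compactness of the set applies. *)
move=> Kc /subspace_valL_continuousP gc.
have [M [_ /(_ (M + 1))]] := compact_bounded (continuous_compact gc Kc).
rewrite ltrDl ltr01 => /(_ isT) gM.
exists `|M + 1| => // t; apply: le_trans (ler_norm _); apply: gM.
by exists (set_val t); [exact: set_valP|rewrite -[in RHS](valLK point g)].
Qed.

Lemma gasket_preimage (R : realType) (x : 'I_3 -> 'rV[R]_2)
    (K : set 'rV[R]_2) :
  is_sierpinski_gasket x K -> forall t : K,
  exists i, exists s : K, set_val t = gasket_map x i (set_val s).
Proof.
move=> [_ _ KE] t; have : forall v, K v -> (\bigcup_i (gasket_map x i @` K)) v.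
  by move=> v Kv; rewrite -KE.
move=> /(_ _ (set_valP t)) [i _ [s Ks st]].
by exists i, (SigSub (mem_set Ks)); exact: esym.
Qed.

(** Pasting along finitely many closed cells: near [t0], a cell containing [t0] is controlled by the
    continuous inverse [2 *: t - x i], and any other cell is avoided. *)
Lemma gasket_pasting (R : realType) (x : 'I_3 -> 'rV[R]_2)
    (K : set 'rV[R]_2) (c : 'I_3 -> R) (q g F : K -> R) :
  is_sierpinski_gasket x K -> continuous q -> continuous g ->
  (forall i (s t : K), set_val t = gasket_map x i (set_val s) ->
    F t = q t + c i * g s) ->
  continuous F.
Proof.
move=> hK qc gc FE t0; have [K0 Kc KE] := hK.
have FF : Filter (nbhs t0) := nbhs_filter t0.
apply/(@cvgrPdist_lt _ _ _ _ FF) => e e0.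
have val_c : continuous (set_val : K -> 'rV[R]_2) by exact: initial_continuous.
have mapc i : continuous (gasket_map x i).
  move=> t; apply: (@continuousZl_tmp R _ 'rV[R]_2 (fun t => t + x i)).
  by apply: continuousD; [by []|exact: cst_continuous].
have near_cell i : \forall t \near t0, forall s : K,
    set_val t = gasket_map x i (set_val s) -> `|F t0 - F t| < e.
  have [[s0 t0E]|t0N] :=
      pselect (exists s : K, set_val t0 = gasket_map x i (set_val s)).
    have : \forall s \near s0, `|c i * g s0 - c i * g s| < e / 2.
      have FF0 : Filter (nbhs s0) := nbhs_filter s0.
      have : (fun s => c i * g s) @ s0 --> c i * g s0.
        by apply: (@cvgM _ _ _ FF0); [exact: cvg_cst|exact: gc].
      by move/(@cvgrPdist_lt _ _ _ _ FF0); apply; rewrite divr_gt0.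
    (* The neighbourhood is taken as the trace of an open [W] of the plane, since [2 *: t - x i] may
       leave [K] when [t] is outside the cell. *)
    move=> [_ [[/= W oW <-] /= Ws0 Wsub]].
    have : \forall t \near t0, W (2 *: set_val t - x i).
      have inv_c : (fun t : K => 2 *: set_val t - x i) @ t0 --> set_val s0.
        rewrite (_ : set_val s0 = 2 *: set_val t0 - x i); last first.
          by rewrite t0E double_gasket_map addrK.
        apply: cvgB; last exact: cvg_cst.
        by apply: cvgZl_tmp; exact: val_c.
      by apply: inv_c; apply: open_nbhs_nbhs.
    have : \forall t \near t0, `|q t0 - q t| < e / 2.
      by move/cvgrPdist_lt : (qc t0); apply; rewrite divr_gt0.
    apply: filterS2 => t qt Wt s tE.
    have : W (set_val s).
      by move: Wt; rewrite tE double_gasket_map addrK.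
    move=> /Wsub /= gs; rewrite (FE _ _ _ t0E) (FE _ _ _ tE).
    rewrite opprD addrACA (le_lt_trans (ler_normD _ _))//; lra.
  have : \forall t \near t0, (~` (gasket_map x i @` K)) (set_val t).
    apply: val_c; apply: open_nbhs_nbhs; split.
      apply: closed_openC; apply: compact_closed; first exact: norm_hausdorff.
      by apply: continuous_compact => //; exact: continuous_subspaceT.
    by move=> [s Ks st]; apply: t0N; exists (SigSub (mem_set Ks)).
  apply: filterS => t tN s tE; exfalso; apply: tN.
  by exists (set_val s); [exact: set_valP|].
have := filter_forall FF near_cell; apply: filterS => t /= near_t.
by have [i [s]] := gasket_preimage hK t; exact: near_t.
Qed.

(** * Addresses of points and existence of fractal functions *)

Lemma gasket_vertex_preimage (R : realType) (x : 'I_3 -> 'rV[R]_2)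
    (K : set 'rV[R]_2) (i j : 'I_3) (s : 'rV[R]_2) :
  equilateral x -> is_sierpinski_gasket x K -> K (x i) -> K s ->
  x i = gasket_map x j s -> s = x i.
Proof.
move=> xE hK Kxi Ks xis.
(* As a fixed point of its own map, [x i] lies in cell [i]; lying in another cell [j] too makes it
   an overlap point. *)
have fixi : gasket_map x i (x i) = x i.
  by apply/rowP => k; rewrite !mxE; lra.
have [ij|ij] := eqVneq i j.
  by move: xis; rewrite -{1}fixi -ij => /gasket_map_inj.
have ji : j != i by rewrite eq_sym.
by apply: (gasket_overlap xE hK ji Ks Kxi); rewrite -xis fixi.
Qed.

(** This makes the choice of address harmless for functions that vanish at the vertices. *)
Lemma gasket_cell_unique (R : realType) (x : 'I_3 -> 'rV[R]_2)
    (K : set 'rV[R]_2) (i j : 'I_3) (s s' : K) :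
  equilateral x -> is_sierpinski_gasket x K ->
  gasket_map x i (set_val s) = gasket_map x j (set_val s') ->
  i = j /\ s = s' \/
  (exists k, set_val s = x k) /\ (exists k, set_val s' = x k).
Proof.
move=> xE hK ss'; have [ij|ij] := eqVneq i j.
  left; split=> //; apply: val_inj.
  by move: ss'; rewrite -ij => /gasket_map_inj.
right; have Ks := set_valP s; have Ks' := set_valP s'.
split; [exists j|exists i].
  exact: (gasket_overlap xE hK ij Ks Ks' ss').
by apply: (gasket_overlap xE hK _ Ks' Ks (esym ss')); rewrite eq_sym.
Qed.

Lemma fractal_fun_exists (R : realType) (x : 'I_3 -> 'rV[R]_2)
    (K : set 'rV[R]_2) (f b : cont_fun K) (r : R) (alpha : 'rV[R]_3) :
  equilateral x -> is_sierpinski_gasket x K ->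
  (forall (i : 'I_3) (p : K), set_val p = x i -> b p = f p) ->
  0 <= r < 1 -> (forall i, `|alpha 0 i| <= r) ->
  exists g : cont_fun K, is_fractal_fun x f b alpha g.
Proof.
move=> xE hK fb r01 alphar; have [K0 Kc KE] := hK.
have /choice[addr addrE] : forall t : K, exists p : 'I_3 * K,
    set_val t = gasket_map x p.1 (set_val p.2).
  by move=> t; have [i [s st]] := gasket_preimage hK t; exists (i, s).
pose vertex (t : K) := exists k, set_val t = x k.
pose sigma t := (addr t).2; pose a t := alpha 0 (addr t).1.
pose q t := f t - b t.
have q0 t : vertex t -> q t = 0.
  by move=> [k /fb]; rewrite /q => ->; rewrite subrr.
have sigma_vertex t : vertex t -> vertex (sigma t).
  move=> [k tk]; exists k; apply: (gasket_vertex_preimage xE hK).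
  - by rewrite -tk; exact: set_valP.
  - exact: set_valP.
  - by rewrite -tk; exact: addrE.
have cell (g : K -> R) i s t : (forall p, vertex p -> g p = 0) ->
    set_val t = gasket_map x i (set_val s) ->
    a t * g (sigma t) = alpha 0 i * g s.
  move=> g0; rewrite addrE => /(gasket_cell_unique xE hK) [[<- <-]//|[vt vs]].
  by rewrite !g0// !mulr0.
have qc : continuous q.
  move=> t; apply: (@cvgB _ _ _ (nbhs t) (nbhs_filter t)); exact: cts_fun.
have [M M0 qM] := cts_gasket_bounded Kc qc.
have [e eE eM] := discounted_sum sigma r01 M0 (fun t => alphar (addr t).1) qM.
set B := M / (1 - r) in eM.
(* Partial sums written as iterates from 0, the form needed for pasting. Starting at 0 makes the
   bound [B] of [e] the initial error in [eS]. *)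
pose S := fix S n t := if n is m.+1 then q t + a t * S m (sigma t) else 0 : R.
have S0 n p : vertex p -> S n p = 0.
  elim: n p => [//|n IHn] p pv /=.
  by rewrite q0// IHn ?mulr0 ?addr0//; exact: sigma_vertex.
have Sc n : continuous (S n).
  elim: n => [|n IHn]; first exact: cst_continuous.
  apply: (gasket_pasting hK qc IHn (c := alpha 0)) => i s t st /=.
  by congr (_ + _); exact: cell (S0 n) st.
have eS n t : `|e t - S n t| <= B * r ^+ n.
  elim: n t => [|n IHn] t /=; first by rewrite subr0 mulr1.
  rewrite eE opprD addrACA subrr add0r -mulrBr normrM exprS mulrCA.
  by apply: ler_pM => //; exact: alphar.
have eps_geo eps : 0 < eps -> \forall n \near \oo, B * r ^+ n < eps.
  move=> eps0; have [r0 r1] := andP r01.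
  have rN1 : `|r| < 1 by rewrite ger0_norm.
  have /cvgrPdist_lt/(_ _ eps0) := cvg_geometric B rN1.
  by apply: filterS => n; rewrite sub0r normrN; exact: le_lt_trans (ler_norm _).
(* Vanishing at vertices passes from the [S n] to their limit, so that [cell] applies to [e]
   itself. *)
have e0 p : vertex p -> e p = 0.
  move=> pv; apply/eqP; rewrite -normr_le0; apply/ler_addgt0Pl => eps eps0.
  have [n nE] := filter_ex (eps_geo _ eps0).
  by rewrite addr0 ltW// (le_lt_trans _ nE)// -[e p]subr0 -(S0 n p pv) eS.
have ec : continuous e.
  apply: (@uniform_limit_continuous _ _ (S @ \oo)).
    have : \forall n \near \oo, continuous (S n) by exact: nearW.
    by [].
  move=> P /uniform_nbhs [E [+ EP]].
  rewrite -entourage_ballE => -[eps eps0 epsE].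
  have : \forall n \near \oo, P (S n).
    apply: filterS (eps_geo _ eps0) => n nE; apply: EP => t _; apply: epsE.
    by rewrite /= -ball_normE /=; exact: le_lt_trans (eS n t) nE.
  by [].
have gc : continuous (fun t => e t + b t).
  move=> t; apply: (@cvgD _ _ _ (nbhs t) (nbhs_filter t)); first exact: ec.
  exact: cts_fun.
exists (mkcts gc) => i s t st; rewrite /= /mkcts addrK eE (cell e i s t e0 st).
by rewrite /q; ring.
Qed.

(** * Lipschitz dependence on the scale vector *)

Lemma coord_le_norm (R : realType) n (i : 'I_n) (v : 'rV[R]_n) :
  `|v 0 i| <= `|v|.
Proof.
rewrite [leRHS]/Num.Def.normr /= mx_normrE.
by apply/bigmax_geP; right; exists (0, i).
Qed.

Lemma cts_gasketB (R : realType) (K : set 'rV[R]_2) (g h : cont_fun K) :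
  continuous (g \- h).
Proof.
by move=> t; apply: (@cvgB _ _ _ _ (nbhs_filter t)); exact: cts_fun.
Qed.

Lemma sup_norm_ub (R : realType) (K : set 'rV[R]_2) (g : K -> R) (t : K) :
  compact K -> continuous g -> `|g t| <= sup_norm g.
Proof.
move=> Kc gc; have [C _ gC] := cts_gasket_bounded Kc gc.
by apply: ub_le_sup; [exists C => _ [s _ <-]|exists t].
Qed.

(* With D = sup_norm (g - h), the two functional equations at t = u_i(s) give
   D <= r D + `|alpha - beta| M. *)
Lemma fractal_fun_dist (R : realType) (x : 'I_3 -> 'rV[R]_2)
    (K : set 'rV[R]_2) (f b g h : cont_fun K) (r M : R)
    (alpha beta : 'rV[R]_3) :
  is_sierpinski_gasket x K -> r < 1 -> `|alpha| <= r ->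
  is_fractal_fun x f b alpha g -> is_fractal_fun x f b beta h ->
  (forall t, `|h t - b t| <= M) ->
  sup_norm (g \- h) <= `|alpha - beta| * (M / (1 - r)).
Proof.
move=> hK r1 alphar gE hE hM; have [[v Kv] Kc _] := hK.
rewrite mulrA ler_pdivlMr ?subr_gt0// mulrBr mulr1 lerBlDr.
have ubD t := sup_norm_ub t Kc (cts_gasketB (g := g) (h := h)).
set D := sup_norm _ in ubD *.
apply: ge_sup => [|_ [t _ <-] /=].
  by exists `|g (SigSub (mem_set Kv)) - h (SigSub (mem_set Kv))|,
    (SigSub (mem_set Kv)).
have [i [s st]] := gasket_preimage hK t.
rewrite (gE _ _ _ st) (hE _ _ _ st).
(* This splitting puts [h], not [g], next to the difference of scales, so [M] stays fixed while
   [alpha] varies. *)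
rewrite (_ : _ - _ = (alpha 0 i - beta 0 i) * (h s - b s) +
  alpha 0 i * (g s - h s)); last by ring.
apply: le_trans (ler_normD _ _) _; rewrite !normrM [D * r]mulrC.
rewrite lerD// ler_pM//.
- by have := coord_le_norm i (alpha - beta); rewrite !mxE.
- exact: le_trans (coord_le_norm i alpha) alphar.
- exact: ubD.
Qed.

Theorem theorem3p1 (R : realType) (x : 'I_3 -> 'rV[R]_2) (K : set 'rV[R]_2)
    (f b : cont_fun K) (r : R)
    (hx : equilateral x)
    (hK : is_sierpinski_gasket x K)
    (hfb : forall (i : 'I_3) (p : K), set_val p = x i -> b p = f p)
    (hr : r < 1) :
  sup_norm_continuous
    (fun alpha : scale_vectors r => fractal_fun x f b (set_val alpha)).
Proof.
move=> beta; have [[v Kv] Kc _] := hK.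
have fractalP (alpha : scale_vectors r) :
    is_fractal_fun x f b (set_val alpha) (fractal_fun x f b (set_val alpha)).
  have alphar : `|set_val alpha| <= r := set_valP alpha.
  apply: (xgetPex f); apply: (fractal_fun_exists hx hK hfb (r := r)).
    (* A scale vector of norm at most [r] forces [0 <= r]. *)
    by rewrite hr andbT (le_trans _ alphar).
  by move=> i; exact: le_trans (coord_le_norm _ _) alphar.
set h := fractal_fun x f b (set_val beta).
have [M _ hM] := cts_gasket_bounded Kc (cts_gasketB (g := h) (h := b)).
have FF : Filter (nbhs beta) := nbhs_filter beta.
(* The distance is squeezed between 0 and the Lipschitz bound at the fixed [beta]. *)
apply: (@squeeze_cvgr _ _ FF _ (cst 0)
  (fun alpha => `|set_val alpha - set_val beta| * (M / (1 - r)))).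
- apply: nearW => alpha; apply/andP; split.
    apply: le_trans (normr_ge0 _) (sup_norm_ub (SigSub (mem_set Kv)) Kc _).
    exact: cts_gasketB.
  apply: fractal_fun_dist hK hr _ (fractalP _) (fractalP _) hM.
  exact: (set_valP alpha).
- exact: (@cvg_cst _ _ _ _ FF).
- rewrite -[X in _ --> X](mul0r (M / (1 - r))).
  rewrite -(@normr0 _ 'rV[R]_3) -(subrr (set_val beta)).
  apply: (@cvgM _ _ _ FF); last exact: (@cvg_cst _ _ _ _ FF).
  apply: (@cvg_norm _ _ _ _ FF).
  apply: (@cvgB _ _ _ _ FF); last exact: (@cvg_cst _ _ _ _ FF).
  exact: initial_continuous.
Qed.
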